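(* Let $k\geq 2$ and $s$ be positive integers. There exists a constant $C=C(k,s)$ such that the following holds. Let $G=(V,E)$ be a graph with $n$ vertices and at least $Cn^{1+1/k}$ edges. Let $\sim$ be a symmetric binary relation on $V$ such that for all $u,v\in V$, $v$ has at most $s$ neighbours $w$ with $u\sim w$. Let $\approx$ be a binary relation on $E$ such that for every $uv\in E$ and $w\in V$, $w$ has at most $s$ neighbours $z$ with $uv\approx wz$. Then $G$ contains a cycle $x_1x_2\dots x_{2k}$ of length $2k$ (with distinct vertices) such that $x_i\not\sim x_j$ for all $i\neq j$ and $x_ix_{i+1}\not\approx x_jx_{j+1}$ for all $i\neq j$, where $x_{2k+1}:=x_1$. *)

(* Defs.v *)
From mathcomp Require Import all_boot.
From Stdlib Require Import Reals.
Set Implicit Arguments. Unset Strict Implicit. Unset Printing Implicit Defensive.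

Section Graphs.
Variable V : finType.

Definition simple_graph (e : rel V) : Prop :=
  (forall u v, e u v = e v u) /\ (forall u, ~~ e u u).

Definition edges (e : rel V) : {set {set V}} :=
  [set A : {set V} | [exists u, exists v, e u v && (A == [set u; v])]].

Definition nbhd (e : rel V) (v : V) : {set V} := [set w | e v w].
End Graphs.

(* Successor index in a cycle of length m: x_{i+1}, with x_{m} := x_0. *)
Definition cyc_next (m : nat) (i : 'I_m) : 'I_m := ordS i.

(* Main.v *)
(** Pass to a subgraph whose minimum degree is at least half the average
    degree, hence at least a large multiple of n^(1/k), and give a closed
    2l-walk x_0 ... x_(2l-1) the weight prod_i 1 / deg(x_i). The total weight
    H_l of the closed 2l-walks is the trace of the 2l-th power of the
    random-walk operator: H_0 = n, H_l >= 1 and H is log-convex, so that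
    H_(k-1) <= n^(1/k) H_k.

    Consider a bad event in which x_0 is determined, up to s choices, by
    x_1, ..., x_(k+1). Comparing the weight of the arcs of length k - 1 from x_0
    to x_(k+1) with that of the arcs of length k from x_1 to x_(k+1), with
    threshold r, bounds the weight of the event by r s H_k + H_(k-1) / (r d), d
    being the minimum degree. Up to a rotation or a reflection of the cycle every
    coincidence x_i = x_j, x_i ~ x_j or x_i x_(i+1) ~~ x_j x_(j+1) is such an
    event, and a union bound over all of them leaves a positive weight of good
    cycles. *)

Require Import Defs.
From Stdlib Require Import Reals.
From mathcomp Require Import all_boot all_order all_algebra.
From mathcomp Require Import ring lra zify.
Set Implicit Arguments. Unset Strict Implicit. Unset Printing Implicit Defensive.
Import Order.TTheory GRing.Theory Num.Theory.
Local Open Scope ring_scope.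

(** * Sums over tuples, and the Cauchy-Schwarz inequality *)

Section TupleSums.
Variables (R : realFieldType) (T : finType).

(** [F] takes sequences, not tuples, so that concatenation needs no casts between lengths. *)
Definition sumt n (F : seq T -> R) : R := \sum_(t : n.-tuple T) F t.

Lemma eq_sumt n (F G : seq T -> R) :
  (forall t, size t = n -> F t = G t) -> sumt n F = sumt n G.
Proof. by move=> FG; apply: eq_bigr => t _; rewrite FG ?size_tuple. Qed.

Lemma sumt0 F : sumt 0 F = F [::].
Proof.
by rewrite /sumt (big_pred1 [tuple]) // => t; rewrite (tuple0 t); apply/esym/eqP.
Qed.

Lemma sumtS n F : sumt n.+1 F = \sum_v sumt n (fun t => F (v :: t)).
Proof.
rewrite /sumt pair_big /=.
rewrite (reindex (fun vt : T * n.-tuple T => [tuple of vt.1 :: vt.2])) //=.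
exists (fun t => (thead t, [tuple of behead t])) => [[v t] _|t _] /=.
  by congr (_, _); apply: val_inj.
by rewrite -tuple_eta.
Qed.

Lemma sumtD m n F :
  sumt (m + n) F = sumt m (fun p => sumt n (fun q => F (p ++ q))).
Proof.
elim: m F => [|m IHm] F; first by rewrite sumt0.
by rewrite addSn !sumtS; apply: eq_bigr => v _; rewrite IHm.
Qed.

Lemma mulr_sumtr n c F : c * sumt n F = sumt n (fun t => c * F t).
Proof. by rewrite /sumt mulr_sumr. Qed.

Lemma mulr_sumtl n c F : sumt n F * c = sumt n (fun t => F t * c).
Proof. by rewrite /sumt mulr_suml. Qed.

Lemma exchange_sumt n (I : finType) (F : I -> seq T -> R) :
  \sum_i sumt n (F i) = sumt n (fun t => \sum_i F i t).
Proof. by rewrite /sumt exchange_big. Qed.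

Lemma ler_sumt n (F G : seq T -> R) :
  (forall t, size t = n -> F t <= G t) -> sumt n F <= sumt n G.
Proof. by move=> FG; apply: ler_sum => t _; rewrite FG ?size_tuple. Qed.

Lemma sumt_ffun n (v0 : T) (G : {ffun 'I_n -> T} -> R) :
  \sum_x G x = sumt n (fun t => G [ffun i : 'I_n => nth v0 t i]).
Proof.
rewrite /sumt (reindex (fun t : n.-tuple T => [ffun i : 'I_n => nth v0 t i])) //=.
exists (fun x : {ffun 'I_n -> T} => [tuple x i | i < n]) => [t _|x _] /=.
  by apply: eq_from_tnth => i; rewrite tnth_mktuple ffunE (tnth_nth v0).
by apply/ffunP => i; rewrite ffunE -(tnth_nth v0 [tuple x j | j < n]) tnth_mktuple.
Qed.

End TupleSums.

(** Lagrange's identity: twice the difference of the two sides is the double sum of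
    [w i * w j * (f i * g j - f j * g i) ^+ 2]. *)
Lemma cauchy_schwarz (R : realFieldType) (I : finType) (w f g : I -> R) :
  (forall i, 0 <= w i) ->
  (\sum_i w i * (f i * g i)) ^+ 2 <=
  (\sum_i w i * f i ^+ 2) * (\sum_i w i * g i ^+ 2).
Proof.
move=> w0; set A := \sum_i _; set F := \sum_i _; set G := \sum_i _.
have pol (w1 w2 f1 f2 g1 g2 : R) :
    w1 * f1 ^+ 2 * (w2 * g2 ^+ 2) + w1 * g1 ^+ 2 * (w2 * f2 ^+ 2)
    - w1 * (f1 * g1) * (w2 * (f2 * g2)) *+ 2 = w1 * w2 * (f1 * g2 - f2 * g1) ^+ 2.
  by rewrite mulr2n; ring.
suff: 0 <= F * G *+ 2 - A ^+ 2 *+ 2 by rewrite subr_ge0 lerMn2r.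
have -> : F * G *+ 2 - A ^+ 2 *+ 2 =
    \sum_i \sum_j w i * w j * (f i * g j - f j * g i) ^+ 2.
  have -> : F * G *+ 2 - A ^+ 2 *+ 2 = F * G + G * F - A * A *+ 2.
    by rewrite [G * F]mulrC expr2 mulr2n.
  rewrite /A /F /G !big_distrlr /= -sumrMnl -big_split -sumrB.
  apply: eq_bigr => i _.
  rewrite -sumrMnl -big_split -sumrB; apply: eq_bigr => j _ /=.
  exact: pol.
by apply: sumr_ge0 => i _; apply: sumr_ge0 => j _; rewrite mulr_ge0 ?sqr_ge0 ?mulr_ge0 ?w0.
Qed.

Lemma cauchy_schwarz2 (R : realFieldType) (I J : finType) (w f g : I -> J -> R) :
  (forall i j, 0 <= w i j) ->
  (\sum_i \sum_j w i j * (f i j * g i j)) ^+ 2 <=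
  (\sum_i \sum_j w i j * f i j ^+ 2) * (\sum_i \sum_j w i j * g i j ^+ 2).
Proof.
move=> w0; rewrite !pair_bigA /=.
exact: (@cauchy_schwarz _ _ (fun p => w p.1 p.2) (fun p => f p.1 p.2)
  (fun p => g p.1 p.2)).
Qed.

(** * Random-walk weights and closed walks *)

Section Kernel.
Variables (R : realFieldType) (T : finType) (e : rel T).
Hypothesis e_sym : forall x y, e x y = e y x.
Hypothesis deg_gt0 : forall x, (0 < #|nbhd e x|)%N.

Let a x y : R := (e x y)%:R.
Definition dg x : R := #|nbhd e x|%:R.

Lemma dg_gt0 x : 0 < dg x. Proof. by rewrite ltr0n. Qed.
Lemma dg_neq0 x : dg x != 0. Proof. by rewrite gt_eqF ?dg_gt0. Qed.
Lemma dg_ge0 x : 0 <= dg x. Proof. by rewrite ltW ?dg_gt0. Qed.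
Hint Resolve dg_gt0 dg_neq0 dg_ge0 : core.

Lemma dgE x : dg x = \sum_y a x y.
Proof.
rewrite /dg -sum1_card natr_sum big_mkcond /=; apply: eq_bigr => y _.
by rewrite /a inE; case: (e x y).
Qed.

(* Weighted number of walks of length [l] from [x] to [y], each vertex [z] of
   the walk, endpoints included, contributing a factor [1 / dg z]. *)
Fixpoint walkw l x y : R :=
  if l is l'.+1 then (\sum_z a x z * walkw l' z y) / dg x
  else (x == y)%:R / dg x.

Lemma walkw_ge0 l x y : 0 <= walkw l x y.
Proof.
elim: l x y => [|l IHl] x y /=; rewrite divr_ge0 ?ler0n //.
by apply: sumr_ge0 => z _; rewrite mulr_ge0 ?ler0n.
Qed.

(** The gluing vertex [z] is weighted in both halves; the factor [dg z] corrects this. *)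
Lemma walkwD m n x y :
  walkw (m + n) x y = \sum_z walkw m x z * dg z * walkw n z y.
Proof.
elim: m x => [|m IHm] x.
  rewrite (bigD1 x) //= big1 ?addr0 => [|z /negPf]; last first.
    by rewrite eq_sym => ->; rewrite !mul0r.
  by rewrite eqxx mul1r mulVf ?mul1r.
rewrite addSn /= [RHS](eq_bigr (fun z => \sum_u a x u * (walkw m u z * dg z * walkw n z y) / dg x)).
  rewrite exchange_big /= mulr_suml; apply: eq_bigr => u _.
  by rewrite IHm mulr_sumr mulr_suml.
move=> z _; rewrite !mulr_suml; apply: eq_bigr => u _; ring.
Qed.

Lemma walkw1 x y : walkw 1 x y = a x y / dg x / dg y.
Proof.
rewrite /= (bigD1 y) //= big1 ?addr0 => [|z /negPf->].
  by rewrite eqxx mul1r mulrAC.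
by rewrite mul0r mulr0.
Qed.

Lemma walkw_sym l x y : walkw l x y = walkw l y x.
Proof.
elim: l x y => [|l IHl] x y.
  by rewrite /=; have [->//|/negPf xy] := eqVneq x y; rewrite ?xy ?mul0r.
rewrite -[in RHS]addn1 walkwD [LHS]/= mulr_suml; apply: eq_bigr => z _.
rewrite walkw1 IHl /a e_sym.
by field; rewrite !dg_neq0.
Qed.

(** The trace of the 2l-th power of the random-walk operator, whose l-th power has entries
    [dg y * walkw l x y]. The form as a sum of squares suits Cauchy-Schwarz. *)
Definition hom l : R := \sum_x \sum_y dg x * dg y * walkw l x y ^+ 2.

(** Both sides are the trace of the same power [m + n]. *)
Lemma homE m n l : (m + n = l + l)%N ->
  hom l = \sum_x \sum_y dg x * dg y * (walkw m x y * walkw n x y).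
Proof.
move=> mn; have trE p q : \sum_x dg x * walkw (p + q) x x =
    \sum_x \sum_y dg x * dg y * (walkw p x y * walkw q x y).
  apply: eq_bigr => x _; rewrite walkwD mulr_sumr; apply: eq_bigr => y _.
  by rewrite (walkw_sym q y); ring.
by rewrite -trE mn trE.
Qed.

Lemma hom_trace l : hom l = \sum_x dg x * walkw (l + l) x x.
Proof.
rewrite (homE (erefl (l + l)%N)); apply: eq_bigr => x _.
rewrite walkwD mulr_sumr; apply: eq_bigr => y _.
by rewrite (walkw_sym l y); ring.
Qed.

Lemma hom0 : hom 0 = #|T|%:R.
Proof.
rewrite hom_trace -sum1_card natr_sum; apply: eq_bigr => x _ /=.
by rewrite eqxx mul1r mulfV.
Qed.

Lemma walkw_row l x : \sum_y dg y * walkw l x y = 1.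
Proof.
elim: l x => [|l IHl] x.
  rewrite (bigD1 x) //= eqxx big1 ?addr0 ?mul1r ?mulfV // => y /negPf.
  by rewrite eq_sym => ->; rewrite mul0r mulr0.
under eq_bigr do rewrite /= mulrA mulr_sumr mulr_suml.
rewrite exchange_big /= (eq_bigr (fun z => a x z / dg x)).
  by rewrite -mulr_suml -dgE mulfV.
move=> z _; rewrite -[RHS]mulr1 -(IHl z) mulr_sumr; apply: eq_bigr => y _.
by ring.
Qed.

(** Cauchy-Schwarz of [walkw l] against the constant 1, with weights [dg x * dg y]: as rows sum to
    1, the mixed sum is [D], and the total weight is [D * D]. *)
Lemma hom_ge1 l : (0 < #|T|)%N -> 1 <= hom l.
Proof.
move=> T0; set D := \sum_x dg x.
have D0 : 0 < D.
  have /card_gt0P[x _] := T0.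
  by rewrite /D (bigD1 x) //= ltr_wpDr ?sumr_ge0.
have := @cauchy_schwarz2 R T T (fun x y => dg x * dg y) (walkw l) (fun _ _ => 1)
  (fun x y => mulr_ge0 (dg_ge0 x) (dg_ge0 y)).
have -> : \sum_x \sum_y dg x * dg y * (walkw l x y * 1) = D.
  apply: eq_bigr => x _; rewrite -[RHS]mulr1 -[in RHS](walkw_row l x) mulr_sumr.
  by apply: eq_bigr => y _; ring.
have -> : \sum_x \sum_y dg x * dg y * 1 ^+ 2 = D * D.
  rewrite big_distrlr; apply: eq_bigr => x _; apply: eq_bigr => y _ /=.
  by rewrite expr1n mulr1.
by rewrite -expr2 -/(hom l) -[leLHS]mul1r ler_pM2r // exprn_gt0.
Qed.

Lemma hom_logconvex l : hom l.+1 ^+ 2 <= hom l * hom l.+2.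
Proof.
rewrite (@homE l l.+2 l.+1); last by lia.
exact: (@cauchy_schwarz2 R T T (fun x y => dg x * dg y) (walkw l) (walkw l.+2)
  (fun x y => mulr_ge0 (dg_ge0 x) (dg_ge0 y))).
Qed.

Lemma hom_power l : (0 < #|T|)%N -> hom l ^+ l.+1 <= #|T|%:R * hom l.+1 ^+ l.
Proof.
move=> T0; have h0 m : 0 < hom m by apply: lt_le_trans (hom_ge1 m T0).
elim: l => [|l IHl]; first by rewrite hom0 expr0 mulr1.
(* Multiplied by [hom l.+1 ^+ l], the left side becomes a power of [hom l.+1 ^+ 2]; log-convexity
   and then the induction hypothesis apply. *)
rewrite -(ler_pM2l (exprn_gt0 l (h0 l.+1))) -exprD.
have -> : (l + l.+2 = 2 * l.+1)%N by lia.
rewrite exprM; apply: le_trans (lerXn2r l.+1 _ _ (hom_logconvex l)) _.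
- by rewrite nnegrE sqr_ge0.
- by rewrite nnegrE mulr_ge0 // ltW.
rewrite exprMn mulrA [_ * #|T|%:R]mulrC ler_pM2r ?exprn_gt0 //.
Qed.

(** * Weights of single walks and of bad events *)

(** Unlike in [walkw], the start [x] carries no factor [1 / dg x]: weights multiply under
    concatenation, and a closed walk counts its base point once. *)
Fixpoint pathw x p : R :=
  if p is y :: p' then a x y / dg y * pathw y p' else 1.

Lemma pathw_cat x p q : pathw x (p ++ q) = pathw x p * pathw (last x p) q.
Proof. by elim: p x => [|y p IHp] x /=; rewrite ?mul1r // IHp mulrA. Qed.

Lemma pathw_ge0 x p : 0 <= pathw x p.
Proof.
by elim: p x => [|y p IHp] x //=; rewrite mulr_ge0 ?divr_ge0 ?ler0n.
Qed.

Lemma sumt_pathw n x G :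
  sumt n (fun p => pathw x p * G (last x p)) = \sum_z dg x * walkw n x z * G z.
Proof.
elim: n x => [|n IHn] x.
  rewrite sumt0 mul1r (bigD1 x) //= eqxx big1 ?addr0 => [|z /negPf].
    by rewrite mul1r mulfV ?mul1r.
  by rewrite eq_sym => ->; rewrite mul0r mulr0 mul0r.
rewrite sumtS (eq_bigr (fun y => \sum_z a x y * walkw n y z * G z)).
  rewrite exchange_big; apply: eq_bigr => z _ /=.
  by rewrite -mulr_suml mulrCA mulfV ?mulr1.
move=> y _ /=; under eq_sumt do rewrite -mulrA.
rewrite -mulr_sumtr IHn mulr_sumr; apply: eq_bigr => z _.
by field; rewrite dg_neq0.
Qed.

Lemma sumt_pathw_rcons n x y :
  sumt n (fun q => pathw x (rcons q y)) = dg x * walkw n.+1 x y.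
Proof.
under eq_sumt => q _ do rewrite -cats1 pathw_cat /= mulr1.
rewrite (sumt_pathw n x (fun u => a u y / dg y)) -addn1 walkwD mulr_sumr.
apply: eq_bigr => z _; rewrite walkw1.
by field; rewrite !dg_neq0.
Qed.

(* [x0 :: y :: p ++ q] is a closed walk; given [y :: p] at most [s] choices of
   [x0] are bad.  With z the end of [p], split on whether
   walkw k.-1 x0 z <= r * dg y * walkw k y z: if so, sum over [y :: p] first and
   use the bound on the choices of [x0]; if not, forget badness and sum over y. *)
Lemma bad_weight k s (r delta : R) (B : T -> seq T -> T -> bool) :
  0 < r -> 0 < delta -> (forall x, delta <= dg x) ->
  (forall y p, #|[set v | e y v & B y p v]| <= s)%N ->
  \sum_x0 \sum_y sumt k.+2 (fun p => sumt k (fun q =>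
     pathw x0 (y :: p ++ rcons q x0) * (B y p x0)%:R))
  <= r * s%:R * hom k.+2 + hom k.+1 / (r * delta).
Proof.
move=> r0 dl0 dl Bs.
(* Here [k] is the half-length minus 2. [W1] covers the case below the threshold, with [dg y]
   cancelled; [W2] covers the other case, with badness dropped. *)
pose W1 x y p := r * (a y x * (B y p x)%:R) *
   (pathw y p * (dg (last y p) * walkw k.+2 y (last y p))).
pose W2 x y p := a x y / dg y *
   (pathw y p * (dg (last y p) *
    (walkw k.+1 x (last y p) *
       (r * dg y * walkw k.+2 y (last y p) < walkw k.+1 x (last y p))%R%:R))).
apply: (@le_trans _ _ (\sum_x \sum_y sumt k.+2 (fun p => W1 x y p + W2 x y p))).
  apply: ler_sum => x _; apply: ler_sum => y _; apply: ler_sumt => p _.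
  (* Summing out [q] turns the closing arc into the weight of all walks of length [k.+1] between [x]
     and the end of [p]. *)
  have -> : sumt k (fun q => pathw x (y :: p ++ rcons q x) * (B y p x)%:R) =
    a x y / dg y * pathw y p * (dg (last y p) * walkw k.+1 x (last y p)) * (B y p x)%:R.
    rewrite (walkw_sym _ x) -sumt_pathw_rcons -mulr_sumtl mulr_sumtr.
    by congr (_ * _); apply: eq_sumt => q _ /=; rewrite pathw_cat mulrA.
  rewrite /W1 /W2; set z := last y p.
  have P0 := pathw_ge0 y p; have d0 := dg_gt0 y; have z0 := dg_ge0 z.
  have a0 : 0 <= a x y by rewrite ler0n.
  have -> : a y x = a x y by rewrite /a e_sym.
  set c := a x y / dg y * pathw y p * dg z.
  have c0 : 0 <= c by rewrite !mulr_ge0 // invr_ge0 ltW.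
  set J1 := walkw k.+1 x z; set J2 := walkw k.+2 y z.
  have J10 : 0 <= J1 := walkw_ge0 _ _ _.
  have J20 : 0 <= J2 := walkw_ge0 _ _ _.
  set b := (B y p x)%:R.
  have b0 : 0 <= b by rewrite ler0n.
  have b1 : b <= 1 by rewrite lern1 leq_b1.
  clearbody J1 J2 b.
  have -> : a x y / dg y * pathw y p * (dg z * J1) * b = c * (J1 * b) by rewrite /c; ring.
  have -> : r * (a x y * b) * (pathw y p * (dg z * J2)) = c * (r * dg y * J2 * b).
    by rewrite /c; field; rewrite dg_neq0.
  have -> : a x y / dg y * (pathw y p * (dg z * (J1 * (r * dg y * J2 < J1)%R%:R)))
     = c * (J1 * (r * dg y * J2 < J1)%R%:R) by rewrite /c; ring.
  rewrite -mulrDr ler_wpM2l //.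
  have [_|J12] := boolP (_ < _).
    rewrite mulr1; apply: ler_wpDl; last by rewrite ler_piMr.
    by rewrite !mulr_ge0 // ltW.
  by rewrite mulr0 addr0 ler_wpM2r // leNgt.
have -> : \sum_x \sum_y sumt k.+2 (fun p => W1 x y p + W2 x y p) =
  \sum_y sumt k.+2 (fun p => \sum_x W1 x y p) + \sum_x \sum_y sumt k.+2 (W2 x y).
  under [X in X + _]eq_bigr do rewrite -exchange_sumt.
  rewrite [X in X + _]exchange_big -big_split; apply: eq_bigr => x _ /=.
  by rewrite -big_split; apply: eq_bigr => y _; rewrite /sumt -big_split.
apply: lerD.
  (* Each [y :: p] admits at most [s] bad [x]; summing over [p] then yields a second factor
     [walkw k.+2], hence [hom k.+2]. *)
  apply: (@le_trans _ _ (\sum_y sumt k.+2 (fun p => r * s%:R *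
      (pathw y p * (dg (last y p) * walkw k.+2 y (last y p)))))).
    apply: ler_sum => y _; apply: ler_sumt => p _.
    rewrite -mulr_suml -mulr_sumr; apply: ler_wpM2r.
      by rewrite mulr_ge0 ?pathw_ge0 // mulr_ge0 ?walkw_ge0.
    rewrite ler_pM2l //; have := Bs y p; rewrite -(ler_nat R); apply: le_trans.
    rewrite -sum1_card natr_sum [leRHS]big_mkcond /=.
    by apply: ler_sum => x _; rewrite /a inE; case: (e y x); case: (B y p x);
      rewrite ?mulr1 ?mulr0.
  under eq_bigr do rewrite -mulr_sumtr (sumt_pathw _ _ (fun z => dg z * walkw k.+2 _ z)).
  rewrite -mulr_sumr; apply: ler_wpM2l; first by rewrite mulr_ge0 ?ler0n ?ltW.
  rewrite le_eqVlt; apply/orP; left; apply/eqP.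
  by apply: eq_bigr => y _; apply: eq_bigr => z _; ring.
rewrite (eq_bigr (fun x => \sum_y \sum_z a x y * walkw k.+2 y z * dg z *
    (walkw k.+1 x z * (r * dg y * walkw k.+2 y z < walkw k.+1 x z)%R%:R))); last first.
  move=> x _; apply: eq_bigr => y _; rewrite /W2 -mulr_sumtr.
  rewrite (sumt_pathw _ _ (fun z => dg z * (walkw k.+1 x z *
    (r * dg y * walkw k.+2 y z < walkw k.+1 x z)%R%:R))) mulr_sumr.
  by apply: eq_bigr => z _; field; rewrite dg_neq0.
rewrite /hom mulr_suml; apply: ler_sum => x _.
rewrite exchange_big mulr_suml; apply: ler_sum => z _ /=.
(* Where the indicator is 1, [walkw k.+2 y z] is at most [walkw k.+1 x z / (r * delta)], as
   [delta <= dg y]. Summing [a x y] over [y] then gives back [dg x]. *)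
apply: (@le_trans _ _ (\sum_y a x y * (dg z * walkw k.+1 x z ^+ 2 / (r * delta)))).
  apply: ler_sum => y _.
  have := walkw_ge0 k.+1 x z; have := walkw_ge0 k.+2 y z.
  set J1 := walkw k.+1 x z; set J2 := walkw k.+2 y z => J20 J10.
  have rdl0 : 0 < r * delta by rewrite mulr_gt0.
  have -> : a x y * J2 * dg z * (J1 * (r * dg y * J2 < J1)%R%:R) =
      a x y * dg z * J1 * (J2 * (r * dg y * J2 < J1)%R%:R) by ring.
  have -> : a x y * (dg z * J1 ^+ 2 / (r * delta)) =
      a x y * dg z * J1 * (J1 / (r * delta)) by rewrite expr2 !mulrA.
  clearbody J1 J2; apply: ler_wpM2l; first by rewrite !mulr_ge0 ?ler0n.
  have [J12|_] := boolP (_ < _); last by rewrite mulr0 divr_ge0 // ltW.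
  rewrite mulr1 ler_pdivlMr //; apply: le_trans (ltW J12).
  by rewrite mulrC ler_wpM2r // ler_pM2l.
by rewrite -mulr_suml -dgE !mulrA.
Qed.
End Kernel.

(** * Closed walks on a cyclic index set and their dihedral symmetry *)

Section Cycles.
Variables (R : realFieldType) (T : finType) (e : rel T).
Hypothesis e_sym : forall x y, e x y = e y x.
Hypothesis deg_gt0 : forall x, (0 < #|nbhd e x|)%N.
Local Notation dg := (dg R e).
Local Notation hom := (hom R e).
Local Notation pathw := (pathw R e).

(** With at least two indices, ['I_n.+2] is the ring of integers mod [n.+2], and [i + 1] is the
    cyclic successor. *)
Definition cyclew n (x : {ffun 'I_n.+2 -> T}) : R :=
  \prod_i ((e (x i) (x (i + 1)))%:R / dg (x (i + 1))).

Lemma cyclew_ge0 n (x : {ffun 'I_n.+2 -> T}) : 0 <= cyclew x.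
Proof. by apply: prodr_ge0 => i _; rewrite divr_ge0 ?ler0n. Qed.

Lemma cyclew_edge n (x : {ffun 'I_n.+2 -> T}) i :
  cyclew x != 0 -> e (x i) (x (i + 1)).
Proof.
move=> /prodf_neq0/(_ i isT); apply: contraNT => /negPf->.
by rewrite mul0r.
Qed.

Lemma pathwE v0 x p : pathw x p =
  \prod_(i < size p) ((e (nth v0 (x :: p) i) (nth v0 p i))%:R / dg (nth v0 p i)).
Proof.
elim: p x => [|y p IHp] x; first by rewrite big_ord0.
by rewrite big_ord_recl /= IHp.
Qed.

Lemma val_ordD1 n (i : 'I_n.+2) :
  (i + 1 : 'I_n.+2) = (if i == n.+1 :> nat then 0 else i.+1)%N :> nat.
Proof.
rewrite /= modnDmr addn1; case: eqP => [->|/eqP ni]; first by rewrite modnn.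
by rewrite modn_small // ltnS ltn_neqAle ni -ltnS ltn_ord.
Qed.

Lemma cyclew_seq n v0 x0 p : size p = n.+1 ->
  cyclew [ffun i : 'I_n.+2 => nth v0 (x0 :: p) i] = pathw x0 (rcons p x0).
Proof.
move=> sp; rewrite (pathwE v0) size_rcons sp; apply: eq_bigr => i _.
have -> : nth v0 (x0 :: rcons p x0) i = nth v0 (x0 :: p) i.
  by rewrite -rcons_cons nth_rcons /= sp ltn_ord.
have -> : nth v0 (rcons p x0) i = nth v0 (x0 :: p) (i + 1)%R.
  rewrite nth_rcons sp val_ordD1 -[_ == n.+1 :> nat]/(_ == _).
  by case: (ltngtP i n.+1) => //; rewrite ltnNge -ltnS ltn_ord.
by rewrite !ffunE.
Qed.

(** Cuts the cycle into the pieces [x0], [y], [p], [q] of [bad_weight]; [v0] is only a default for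
    [nth]. *)
Lemma sum_cyclew k (G : {ffun 'I_(k.+2 + k).+2 -> T} -> R) (v0 : T) :
  \sum_x cyclew x * G x = \sum_x0 \sum_y sumt k.+2 (fun p => sumt k (fun q =>
    pathw x0 (y :: p ++ rcons q x0) *
    G [ffun i : 'I_(k.+2 + k).+2 => nth v0 [:: x0, y & p ++ q] i])).
Proof.
rewrite (sumt_ffun v0) sumtS; apply: eq_bigr => x0 _.
rewrite sumtS; apply: eq_bigr => y _.
rewrite sumtD; apply: eq_sumt => p sp; apply: eq_sumt => q sq.
by rewrite cyclew_seq ?rcons_cons ?rcons_cat //= size_cat sp sq.
Qed.

Lemma total_weight k : (0 < #|T|)%N ->
  \sum_(x : {ffun 'I_(k.+2 + k).+2 -> T}) cyclew x = hom k.+2.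
Proof.
move=> /card_gt0P[v0 _].
under eq_bigr do rewrite -[cyclew _]mulr1.
rewrite (sum_cyclew (fun=> 1) v0) (hom_trace R e_sym deg_gt0).
apply: eq_bigr => x0 _.
have -> : (k.+2 + k.+2 = (1 + k.+2 + k).+1)%N by lia.
rewrite -(sumt_pathw_rcons R deg_gt0) !sumtD sumtS; apply: eq_bigr => y _.
rewrite sumt0; apply: eq_sumt => p _; apply: eq_sumt => q _ /=.
by rewrite mulr1 rcons_cat.
Qed.

Definition dih n (b : bool) (j i : 'I_n.+2) := if b then j - i else j + i.

Lemma dih_inj n b j : injective (@dih n b j).
Proof.
by case: b => i i' /=; [move/addrI/oppr_inj|move/addrI].
Qed.

Lemma cyclew_dih n b j (x : {ffun 'I_n.+2 -> T}) :
  cyclew [ffun i => x (dih b j i)] = cyclew x.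
Proof.
rewrite /cyclew !big_split /=; congr (_ * _); last first.
  rewrite [LHS](reindex_inj (addIr (-1))) [RHS](reindex_inj (@dih_inj n b j)).
  rewrite [RHS](reindex_inj (addIr (if b then 1 else -1))).
  apply: eq_bigr => i _; rewrite ffunE.
  by congr ((dg (x _))^-1); rewrite /dih; case: b; ring.
rewrite [RHS](reindex_inj (@dih_inj n b j)).
(* A reflection traverses edges backwards, hence the shift by 1 and the use of [e_sym]. *)
rewrite [RHS](reindex_inj (addIr (if b then 1 else 0))).
apply: eq_bigr => i _; rewrite !ffunE; case: b => /=.
  rewrite e_sym; congr ((e (x _) (x _))%:R); ring.
by congr ((e (x _) (x _))%:R); ring.
Qed.

Lemma sum_cyclew_dih n b j (G : {ffun 'I_n.+2 -> T} -> R) :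
  \sum_x cyclew x * G [ffun i => x (dih b j i)] = \sum_x cyclew x * G x.
Proof.
rewrite [RHS](reindex_inj (h := fun x : {ffun 'I_n.+2 -> T} => [ffun i => x (dih b j i)])) /=.
  by apply: eq_bigr => x _; rewrite cyclew_dih.
move=> x x' /ffunP xx'; apply/ffunP => i; have [g _ gK] := injF_bij (@dih_inj n b j).
by have := xx' (g i); rewrite !ffunE gK.
Qed.

(** * The weight of one bad event *)

Section Events.
Variables (k s : nat) (r delta : R).
Hypotheses (r_gt0 : 0 < r) (delta_gt0 : 0 < delta).
Hypothesis delta_le : forall x, delta <= dg x.
Local Notation ix := 'I_(k.+2 + k).+2.
Local Notation bound := (r * s%:R * hom k.+2 + hom k.+1 / (r * delta)).

(** Positions 1 to [k.+3] are exactly those of [y :: p], so once these are fixed at most [s] values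
    of [x 0] satisfy [Q]. *)
Lemma near_event_weight (Q : T -> T -> T -> T -> bool) (a b : ix) :
  (forall t u v, #|[set w | e v w & Q t u v w]| <= s)%N ->
  (0 < a <= k.+3)%N -> (0 < b <= k.+3)%N ->
  \sum_(x : {ffun ix -> T}) cyclew x * (Q (x a) (x b) (x 1) (x 0))%:R <= bound.
Proof.
move=> Qs /andP[a0 ak] /andP[b0 bk].
(* A default vertex is needed for [nth]; over an empty [T] both sides vanish. *)
case: (pickP [pred v : T | true]) => [v0 _|T0]; last first.
  rewrite big1 => [|x _]; last by have := T0 (x 0).
  by rewrite /hom !big_pred0 ?mulr0 ?mul0r ?addr0 // => v; have := T0 v.
pose B y p := Q (nth v0 (y :: p) a.-1) (nth v0 (y :: p) b.-1) y.
apply: le_trans (bad_weight e_sym deg_gt0 k r_gt0 delta_gt0 delta_le (B := B) _);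
  last by move=> y p; apply: Qs.
rewrite (sum_cyclew _ v0); apply: ler_sum => x0 _; apply: ler_sum => y _.
apply: ler_sumt => p sp; apply: ler_sumt => q sq; rewrite !ffunE /=.
have nthE (c : nat) : (0 < c <= k.+3)%N ->
    nth v0 [:: x0, y & p ++ q] c = nth v0 (y :: p) c.-1.
  by case: c => //= c ck; rewrite -cat_cons nth_cat /= sp [(c < _)%N]ck.
by rewrite !nthE ?a0 ?b0.
Qed.

(** A rotation, or else a reflection, carries [j] to 0 and [i] into the range from 1 to [k.+3]. *)
Lemma vertex_event_weight (rl : rel T) (i j : ix) :
  (forall u v, #|[set w | e v w & rl u w]| <= s)%N -> i != j ->
  \sum_(x : {ffun ix -> T}) cyclew x * (rl (x i) (x j))%:R <= bound.
Proof.
move=> rls ij.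
have [b [t [tk it]]] : exists b, exists t : ix, (0 < t <= k.+3)%N /\ i = dih b j t.
  have t0 : i - j != 0 by rewrite subr_eq0.
  have [tk|tk] := leqP (i - j)%R k.+3.
    exists false, (i - j); rewrite tk lt0n t0; split=> //=; ring.
  exists true, (j - i); split; last by rewrite /dih; ring.
  have -> : j - i = - (i - j) by ring.
  move: (i - j) t0 tk => u u0 uk /=.
  have := ltn_ord u; rewrite modn_small; last by lia.
  by lia.
have := near_event_weight (Q := fun u _ _ w => rl u w) (fun u _ => rls u) tk tk.
rewrite -(sum_cyclew_dih b j); apply: le_trans; apply: ler_sum => x _.
by rewrite !ffunE -it /dih subr0 addr0 if_same.
Qed.

(** If [i - j <= k.+2], rotate [j] to 0, so that [i + 1] still lands within [k.+3]. Otherwise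
    reflect, taking [j + 1] to 0 and [j] to 1; then [i + 1] and [i] land at [j - i] and [j - i + 1].
    The swap hypotheses put the ends of edges back in order. *)
Lemma edge_event_weight (ap : T -> T -> T -> T -> bool) (i j : ix) :
  (forall t u v, #|[set w | e v w & ap t u v w]| <= s)%N ->
  (forall t u v w, ap t u v w = ap u t v w) ->
  (forall t u v w, ap t u v w = ap t u w v) -> i != j ->
  \sum_(x : {ffun ix -> T}) cyclew x * (ap (x i) (x (i + 1)) (x j) (x (j + 1)))%:R
    <= bound.
Proof.
move=> aps ap1 ap2 ij.
have t0 : i - j != 0 by rewrite subr_eq0.
have [tk|tk] := leqP (i - j)%R k.+2.
  have a0 : (0 < (i - j)%R <= k.+3)%N by rewrite lt0n t0 ltnW.
  have b0 : (0 < (i - j + 1)%R <= k.+3)%N.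
    by move: (i - j) tk => u; rewrite val_ordD1; case: eqP; lia.
  have := near_event_weight aps a0 b0.
  rewrite -(sum_cyclew_dih false j); apply: le_trans; apply: ler_sum => x _.
  rewrite !ffunE /dih ap2 addr0.
  have -> : j + (i - j) = i by ring.
  by have -> : j + (i - j + 1) = i + 1 by ring.
have vji : (j - i)%R = ((k.+2 + k).+2 - (i - j)%R)%N :> nat.
  have -> : j - i = - (i - j) by ring.
  by move: (i - j) tk => u uk /=; rewrite modn_small //; lia.
have a0 : (0 < (j - i)%R <= k.+3)%N by have := ltn_ord (i - j)%R; lia.
have b0 : (0 < (j - i + 1)%R <= k.+3)%N.
  move: (i - j) (j - i) tk (ltn_ord (i - j)) vji => u v uk un vu.
  by rewrite val_ordD1; case: eqP; lia.
have := near_event_weight aps a0 b0.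
rewrite -(sum_cyclew_dih true (j + 1)); apply: le_trans; apply: ler_sum => x _.
rewrite !ffunE /dih ap1 subr0.
have -> : j + 1 - (j - i) = i + 1 by ring.
have -> : j + 1 - (j - i + 1) = i by ring.
by have -> : j + 1 - 1 = j by ring.
Qed.

End Events.
End Cycles.

(** * The union bound over all bad events *)

Lemma good_cycle (R : realFieldType) (T : finType) (e sim : rel T)
    (ap : T -> T -> T -> T -> bool) (k s : nat) (delta : R) :
  let N := (k.+2 + k).+2 in
  (0 < s)%N -> (0 < #|T|)%N -> (forall x y, e x y = e y x) ->
  0 < delta -> (forall x, delta <= #|nbhd e x|%:R) ->
  (144 * N ^ 4 * s)%:R ^+ k.+2 * #|T|%:R <= delta ^+ k.+2 ->
  (forall u v, #|[set w | e v w & sim u w]| <= s)%N ->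
  (forall t u v, e t u -> #|[set w | e v w & ap t u v w]| <= s)%N ->
  (forall t u v w, ap t u v w = ap u t v w) ->
  (forall t u v w, ap t u v w = ap t u w v) ->
  exists x : {ffun 'I_N -> T},
    [/\ injective x, forall i, e (x i) (x (i + 1)),
        forall i j, i != j -> ~~ sim (x i) (x j) &
        forall i j, i != j -> ~~ ap (x i) (x (i + 1)) (x j) (x (j + 1))].
Proof.
move=> N s0 T0 e_sym dl0 dl dlT sims aps ap1 ap2.
have deg0 x : (0 < #|nbhd e x|)%N by rewrite -(ltr0n R); apply: lt_le_trans (dl x).
(* The bound for [ap] holds only when [t u] is an edge; [ap'] extends it to all pairs and agrees
   with [ap] on walks of nonzero weight. *)
pose ap' t u v w := e t u && ap t u v w.
have aps' t u v : (#|[set w | e v w & ap' t u v w]| <= s)%N.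
  rewrite /ap'; case: (boolP (e t u)) => [/aps//|_].
  by rewrite (eq_card0 (A := [set w | _])) // => w; rewrite inE andbF.
have ap1' t u v w : ap' t u v w = ap' u t v w by rewrite /ap' e_sym ap1.
have ap2' t u v w : ap' t u v w = ap' t u w v by rewrite /ap' ap2.
have eqs u v : (#|[set w | e v w & u == w]| <= s)%N.
  apply: leq_trans s0; rewrite -(cards1 u); apply: subset_leq_card.
  by apply/subsetP => w; rewrite !inE eq_sym => /andP[].
pose bad (x : {ffun 'I_N -> T}) i j :=
  [|| x i == x j, sim (x i) (x j) | ap' (x i) (x (i + 1)) (x j) (x (j + 1))].
have [/existsP[x /andP[x0 /forallP good]]|none] := boolP [exists x : {ffun 'I_N -> T},
    (cyclew R e x != 0) && [forall i, forall j, (i != j) ==> ~~ bad x i j]].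
  have {}good i j : i != j -> ~~ bad x i j.
    by move=> ij; have /forallP/(_ j)/implyP := good i; apply.
  have xe i : e (x i) (x (i + 1)) by exact: cyclew_edge x0.
  exists x; split=> // [i j xij|i j /good|i j /good]; rewrite /bad.
  - by apply/eqP/contraT => /good; rewrite /bad xij eqxx.
  - by rewrite !negb_or => /and3P[].
  - by rewrite !negb_or /ap' xe => /and3P[].
(* [E] bounds the number of events: three kinds for each ordered pair of indices. Below, [r] is
   chosen to make [E * (r * s * h k.+2)] a quarter of [h k.+2]. *)
pose h := hom R e; pose E : R := (3 * N ^ 2)%:R.
have E0 : 0 < E by rewrite ltr0n.
have sR : 0 < s%:R :> R by rewrite ltr0n.
pose r := (4 * E * s%:R)^-1.
have r0 : 0 < r by rewrite invr_gt0 !mulr_gt0.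
pose M := r * s%:R * h k.+2 + h k.+1 / (r * delta).
have h0 l : 0 < h l by apply: lt_le_trans (hom_ge1 R deg0 l T0).
have hE : h k.+2 <= E * M.
  rewrite /h -(total_weight R e_sym deg0) //.
  apply: (@le_trans _ _ (\sum_(x : {ffun 'I_N -> T}) \sum_i \sum_(j | i != j)
     (cyclew R e x * (x i == x j)%:R + cyclew R e x * (sim (x i) (x j))%:R +
      cyclew R e x * (ap' (x i) (x (i + 1)) (x j) (x (j + 1)))%:R))).
    apply: ler_sum => x _; have w0 := cyclew_ge0 R e x.
    have t0 (b1 b2 b3 : bool) : 0 <= cyclew R e x * b1%:R + cyclew R e x * b2%:R
        + cyclew R e x * b3%:R by rewrite !addr_ge0 // mulr_ge0 // ler0n.
    move/existsPn/(_ x): none; rewrite negb_and negbK.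
    case/orP => [/eqP->|]; first by apply: sumr_ge0 => i _; apply: sumr_ge0 => j _;
      rewrite !mul0r !addr0.
    rewrite negb_forall => /existsP[i]; rewrite negb_forall => /existsP[j].
    rewrite negb_imply negbK => /andP[ij badij].
    rewrite (bigD1 i) //= (bigD1 j) //= -addrA; apply: ler_wpDr.
      by apply: addr_ge0; apply: sumr_ge0 => // l _; apply: sumr_ge0.
    rewrite -!mulrDr ler_peMr // -!natrD ler1n.
    move: badij; rewrite /bad.
    by case: (x i == x j); case: (sim _ _); case: (ap' _ _ _ _).
  rewrite exchange_big /=; under eq_bigr do rewrite exchange_big /=.
  have ->: E * M = \sum_(i < N) \sum_(j < N) (M + M + M).
    rewrite !sumr_const !card_ord -!mulrnA /E natrM -mulr_natr expnS expn1; ring.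
  apply: ler_sum => i _; rewrite [leRHS](bigID (fun j => i != j)) /=.
  have M0 : 0 <= M by rewrite addr_ge0 ?divr_ge0 ?mulr_ge0 ?ltW.
  apply: ler_wpDr; first by apply: sumr_ge0 => j _; rewrite addr_ge0 ?M0 // addr_ge0.
  apply: ler_sum => j ij; rewrite !big_split /=.
  apply: lerD; last by apply: edge_event_weight.
  apply: lerD; first by apply: (@vertex_event_weight _ _ _ e_sym deg0 _ _ _ _ r0 dl0 dl eq_op).
  by apply: vertex_event_weight.
(* This makes the other term of [E * M] at most a quarter of [h k.+2] too. It is proved by comparing
   powers, which avoids taking roots. *)
have hratio : 16 * E ^+ 2 * s%:R * h k.+1 <= delta * h k.+2.
  have dh0 : 0 <= delta * h k.+2 by rewrite mulr_ge0 ?ltW.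
  have Eh0 : 0 <= 16 * E ^+ 2 * s%:R * h k.+1 by rewrite !mulr_ge0 ?ltW.
  rewrite -(ler_pXn2r (n := k.+2)) //.
  have -> : 16 * E ^+ 2 * s%:R = (144 * N ^ 4 * s)%:R :> R.
    by rewrite /E -natrX -!natrM; congr (_%:R); ring.
  rewrite !exprMn;
  have hp : h k.+1 ^+ k.+2 <= #|T|%:R * h k.+2 ^+ k.+1 := hom_power R e_sym deg0 k.+1 T0.
  apply: le_trans (ler_wpM2l _ hp) _; first by rewrite exprn_ge0 ?ler0n.
  rewrite mulrA; apply: ler_pM dlT _.
  - exact: mulr_ge0 (exprn_ge0 _ (ler0n _ _)) (ler0n _ _).
  - exact: exprn_ge0 (ltW (h0 _)).
  (* [hom_power] leaves the exponent [k.+1]; the missing factor is at least 1. *)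
  by apply: ler_weXn2l => //; apply: hom_ge1.
suff : E * M < h k.+2 by rewrite ltNge hE.
have -> : E * M = h k.+2 / 4 + 4 * E ^+ 2 * s%:R * h k.+1 / delta.
  by rewrite /M /r; field; rewrite !gt_eqF.
have hdl : 4 * E ^+ 2 * s%:R * h k.+1 / delta <= h k.+2 / 4.
  by rewrite ler_pdivrMr //; lra.
have := h0 k.+2; lra.
Qed.

(** * A subgraph of large minimum degree *)

Lemma card_edges_le (V : finType) (e : rel V) :
  (#|edges e| <= \sum_v #|nbhd e v|)%N.
Proof.
pose P := [set p : V * V | e p.1 p.2].
apply: (@leq_trans #|[set [set p.1; p.2] | p in P]|).
  apply/subset_leq_card/subsetP => A; rewrite inE => /existsP[u /existsP[v /andP[uv /eqP->]]].
  by apply/imsetP; exists (u, v); rewrite ?inE.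
apply: leq_trans (leq_imset_card _ _) _; rewrite -sum1_card.
under [leqRHS]eq_bigr do rewrite -sum1_card.
by rewrite pair_big_dep; apply/eq_leq/eq_bigl => p; rewrite !inE.
Qed.

(** Take a minimal nonempty [S] whose average degree is at least that of the whole graph: deleting a
    vertex of less than half this degree would not lower the average. *)
Lemma min_degree_subgraph (V : finType) (e : rel V) :
  (forall u v, e u v = e v u) -> (0 < \sum_v #|nbhd e v|)%N ->
  exists2 S : {set V}, S != set0 & forall x, x \in S ->
    (\sum_v #|nbhd e v| <= 2 * #|V| * #|nbhd e x :&: S|)%N.
Proof.
move=> e_sym; set m := (\sum_v _)%N => m0.
pose es (S : {set V}) := (\sum_(v in S) #|nbhd e v :&: S|)%N.
pose P (S : {set V}) := (S != set0) && (m * #|S| <= #|V| * es S)%N.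
have PT : P setT.
  apply/andP; split.
    apply: contraL m0 => /eqP VT; rewrite -leqNgt leqn0 sum_nat_eq0.
    by apply/forallP => x; have := in_setT x; rewrite VT inE.
  rewrite cardsT mulnC leq_mul2l; apply/orP; right; apply/eq_leq.
  by apply: eq_big => [x|x _]; rewrite ?inE ?setIT.
have [S /minsetP[/andP[S0 PS] Smin] _] := minset_exists PT.
exists S => // x xS; rewrite leqNgt; apply/negP => small.
(* Deleting [x] loses its own degree and one more for each neighbour in [S]. *)
have esS : (es S <= es (S :\ x) + 2 * #|nbhd e x :&: S|)%N.
  rewrite /es (big_setD1 x) //=.
  have : (\sum_(v in S :\ x) #|nbhd e v :&: S| <=
          \sum_(v in S :\ x) (#|nbhd e v :&: (S :\ x)| + e v x))%N.
    apply: leq_sum => v _; rewrite (cardsD1 x) !inE xS andbT addnC leq_add2r.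
    by rewrite setIDA.
  rewrite big_split /= => le1.
  suff : (\sum_(v in S :\ x) e v x <= #|nbhd e x :&: S|)%N by lia.
  rewrite -sum1_card [leqLHS]big_mkcond [leqRHS]big_mkcond; apply: leq_sum => v _.
  by rewrite !inE e_sym; case: (e x v); case: (v \in S); case: (v != x).
have cS := cardsD1 x S; rewrite xS in cS.
have lt1 : (m * #|S :\ x| < #|V| * es (S :\ x))%N by nia.
have PS' : P (S :\ x).
  (* Strictness in [lt1] shows that [S :\ x] is nonempty. *)
  rewrite /P (ltnW lt1) andbT; apply: contraTneq lt1 => ->.
  by rewrite /es big_set0 muln0 ltn0.
by have /setP/(_ x) := Smin _ PS' (subD1set S x); rewrite !inE eqxx xS.
Qed.

(** * Transfer to the induced subgraph *)

Lemma card_subtype_le (V : finType) (S : {set V}) (P : pred {x | x \in S}) (Q : pred V) :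
  (forall x, P x -> Q (val x)) -> (#|[set x | P x]| <= #|[set x | Q x]|)%N.
Proof.
move=> PQ; rewrite -(card_imset _ val_inj); apply/subset_leq_card/subsetP => y.
by case/imsetP => x; rewrite !inE => /PQ Qx ->.
Qed.

Lemma cyc_nextE n (i : 'I_n.+2) : cyc_next i = i + 1.
Proof. by apply: val_inj; rewrite /= modnDmr addn1. Qed.

Lemma dense_good_cycle (V : finType) (e sim : rel V) (approx : rel {set V}) (k s : nat) :
  let N := (k.+2 + k).+2 in
  simple_graph e -> (0 < s)%N -> (0 < #|edges e|)%N ->
  ((2 * (144 * N ^ 4 * s)) ^ k.+2 * #|V| ^ k.+3 <= #|edges e| ^ k.+2)%N ->
  (forall u v, #|[set w in nbhd e v | sim u w]| <= s)%N ->
  (forall (f : {set V}) (w : V), f \in edges e ->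
     #|[set z in nbhd e w | approx f [set w; z]]| <= s)%N ->
  exists x : 'I_N -> V,
    [/\ injective x, forall i, e (x i) (x (i + 1)),
        forall i j, i != j -> ~~ sim (x i) (x j) &
        forall i j, i != j ->
          ~~ approx [set x i; x (i + 1)] [set x j; x (j + 1)]].
Proof.
move=> N [e_sym e_irr] s0 E0 many sims apps; pose c := (144 * N ^ 4 * s)%N.
have mE := card_edges_le e.
have [S /set0Pn[v0 v0S] Sdeg] := min_degree_subgraph e_sym (leq_trans E0 mE).
have V0 : (0 < #|V|)%N by apply/card_gt0P; exists v0.
pose T : finType := {x | x \in S}.
pose e' : rel T := fun x y => e (val x) (val y).
pose sim' : rel T := fun x y => sim (val x) (val y).
pose ap (t u v w : T) := approx [set val t; val u] [set val v; val w].
pose delta : rat := (#|edges e|%:R / (2 * #|V|)%:R)%R.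
have V2 : (0 < (2 * #|V|)%:R :> rat)%R by rewrite ltr0n muln_gt0.
have degE x : #|nbhd e' x| = #|nbhd e (val x) :&: S|.
  rewrite -(card_imset _ val_inj); apply: eq_card => y; rewrite !inE.
  apply/imsetP/andP => [[z + ->]|[xy yS]]; first by rewrite inE; split=> //; exact: valP.
  by exists (exist _ y yS); rewrite ?inE.
have TS : #|T| = #|S| by rewrite card_sig; apply: eq_card => x; rewrite !inE.
have [||||||||||x [x_inj xe xsim xap]] :=
  @good_cycle rat T e' sim' ap k s delta.
- exact: s0.
- by rewrite TS; apply/card_gt0P; exists v0.
- by move=> x y; exact: e_sym.
- by rewrite divr_gt0 // ltr0n.
- move=> x; rewrite ler_pdivrMr // -natrM ler_nat degE mulnC.
  exact: leq_trans mE (Sdeg _ (valP x)).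
- rewrite -/c expr_div_n ler_pdivlMr ?exprn_gt0 // -!natrX -!natrM ler_nat TS.
  apply: leq_trans many; rewrite -/c; clearbody c.
  rewrite !expnMn [(#|V| ^ k.+3)%N]expnS.
  have -> : (c ^ k.+2 * #|S| * (2 ^ k.+2 * #|V| ^ k.+2) =
      2 ^ k.+2 * c ^ k.+2 * (#|S| * #|V| ^ k.+2))%N by ring.
  by rewrite leq_mul2l leq_mul2r max_card !orbT.
- move=> u v; apply: leq_trans (sims (val u) (val v)); apply: card_subtype_le => w.
  by rewrite inE.
- move=> t u v tu; apply: leq_trans (apps [set val t; val u] (val v) _).
    by apply: card_subtype_le => w; rewrite inE.
  by rewrite inE; apply/existsP; exists (val t); apply/existsP; exists (val u); rewrite eqxx andbT.
- by move=> t u v w; rewrite /ap [X in approx X]setUC.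
- by move=> t u v w; rewrite /ap [X in approx _ X]setUC.
exists (fun i => val (x i)); split=> [i j /val_inj/x_inj//|//|i j|i j].
- exact: xsim.
- exact: xap.
Qed.

(* From real exponents to natural numbers, and the theorem *)
Close Scope ring_scope.
Delimit Scope R_scope with R.

Lemma INR_expn a n : INR (a ^ n)%N = (INR a ^ n)%R.
Proof. by elim: n => [|n IHn] //; rewrite expnS mult_INR IHn. Qed.

(** Raising to the [k]-th power clears the fractional exponent. *)
Lemma Rpower_bound_nat c n k m : (0 < k)%N -> (0 < n)%N ->
  (INR c * Rpower (INR n) (1 + 1 / INR k) <= INR m)%R ->
  (c ^ k * n ^ k.+1 <= m ^ k)%N.
Proof.
move=> k0 n0 le1; apply/ssrnat.leP/INR_le.
have nR : (0 < INR n)%R by apply/lt_0_INR/ssrnat.ltP.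
have kR : INR k <> 0%R by apply/not_0_INR; lia.
rewrite mult_INR !INR_expn.
have <- : (Rpower (INR n) (1 + 1 / INR k) ^ k = INR n ^ k.+1)%R.
  rewrite -Rpower_pow; last exact: exp_pos.
  rewrite Rpower_mult -Rpower_pow //; congr Rpower.
  by rewrite S_INR Rmult_plus_distr_r /Rdiv !Rmult_1_l Rinv_l.
rewrite -Rpow_mult_distr; apply: pow_incr; split=> //.
by apply: Rmult_le_pos; [exact: pos_INR|apply/Rlt_le/exp_pos].
Qed.

Theorem theorem3p1 :
  forall k s : nat, (2 <= k)%N -> (0 < s)%N ->
  exists C : R,
  forall (V : finType) (e : rel V) (sim : rel V) (approx : rel {set V}),
    simple_graph e ->
    (C * Rpower (INR #|V|) (1 + 1 / INR k) <= INR #|edges e|)%R ->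
    (forall u w, sim u w = sim w u) ->
    (forall u v, (#|[set w in nbhd e v | sim u w]| <= s)%N) ->
    (forall (f : {set V}) (w : V), f \in edges e ->
       (#|[set z in nbhd e w | approx f [set w; z]]| <= s)%N) ->
    exists x : 'I_(2 * k) -> V,
      [/\ injective x,
          (forall i, e (x i) (x (cyc_next i))),
          (forall i j, i != j -> ~~ sim (x i) (x j)) &
          (forall i j, i != j ->
             ~~ approx [set x i; x (cyc_next i)] [set x j; x (cyc_next j)])].
Proof.
(* The factor 2 in [c] pays for the minimum degree being [#|edges e| / (2 * #|V|)]; the rest is the
   constant of [good_cycle]. *)
move=> [|[|k]] // s _ s0; pose N := (k.+2 + k).+2; pose c := (2 * (144 * N ^ 4 * s))%N.
exists (INR c) => V e sim approx eP many _ sims apps.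
(* [Rpower] is an exponential, positive even at base 0, so an edge exists and [V] is nonempty. *)
have E0 : (0 < INR #|edges e|)%R.
  apply: Rlt_le_trans many.
  by apply: Rmult_lt_0_compat; [apply/lt_0_INR/ssrnat.ltP; rewrite !muln_gt0 s0|exact: exp_pos].
have {}E0 : (0 < #|edges e|)%N by apply/ssrnat.ltP/INR_lt.
have V0 : (0 < #|V|)%N.
  have /card_gt0P[A] := E0; rewrite inE => /existsP[v _].
  by apply/card_gt0P; exists v.
have {}many := Rpower_bound_nat (ltn0Sn _) V0 many.
have [x [x_inj xe xsim xap]] := dense_good_cycle eP s0 E0 many sims apps.
have -> : (2 * k.+2 = (k.+2 + k).+2)%N by lia.
exists x; split=> // [i|i j]; rewrite !cyc_nextE; [exact: xe|exact: xap].
Qed.
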